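(* Let $E$ be a real Banach lattice, $X$ a real Banach space and $T:E\to X$ a bounded linear operator. Then $T$ is DW-compact if and only if $T$ is both AM-compact and (almost) Dunford-Pettis. That is, the following are equivalent: (i) $T$ is DW-compact; (ii) $T$ is AM-compact and Dunford-Pettis; (iii) $T$ is AM-compact and almost Dunford-Pettis.
   Context: For a subset $A$ of a Banach lattice $E$, the solid hull is $Sol(A)=\{y\in E: |y|\le |x| \text{ for some } x\in A\}$. A bounded subset $A$ of $E$ is disjointly weakly compact if every disjoint sequence in $Sol(A)$ converges weakly to zero. A bounded linear operator $T:E\to X$ is: DW-compact if $T(A)$ is relatively (norm) compact for each disjointly weakly compact subset $A$ of $E$; AM-compact if $T$ maps each order bounded subset of $E$ onto a relatively compact set in $X$; Dunford-Pettis if $\|Tx_n\|\to 0$ for each weakly null sequence $(x_n)$ in $E$; almost Dunford-Pettis if $\|Tx_n\|\to 0$ for each disjoint weakly null sequence $(x_n)$ in $E$. *)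

(* Defs.v *)
From HB Require Import structures.
From mathcomp Require Import all_boot all_order all_algebra.
From mathcomp Require Import all_classical all_reals all_analysis.

Set Implicit Arguments.
Unset Strict Implicit.
Unset Printing Implicit Defensive.

Import Order.TTheory GRing.Theory Num.Theory.
Import numFieldNormedType.Exports.

Local Open Scope classical_set_scope.
Local Open Scope ring_scope.

(* The order of a vector lattice is a separate relation [vle] because Hierarchy
   Builder cannot join [Order.Lattice] with [GRing.Lmodule] below the existing
   [Num.RealDomain]. *)
HB.mixin Record Lmodule_isVectorLattice (R : numDomainType) E
    & GRing.Lmodule R E := {
  vle : rel E;
  vjoin : E -> E -> E;
  vmeet : E -> E -> E;
  vle_refl : reflexive vle;
  vle_anti : antisymmetric vle;
  vle_trans : transitive vle;
  vle_joinl : forall x y z : E, vle (vjoin x y) z = vle x z && vle y z;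
  vle_meetr : forall x y z : E, vle z (vmeet x y) = vle z x && vle z y;
  vle_addr : forall x y z : E, vle x y -> vle (x + z) (y + z);
  vle_scale0 : forall (a : R) (x : E), 0 <= a -> vle 0 x -> vle 0 (a *: x)
}.

#[short(type="vectorLatticeType")]
HB.structure Definition VectorLattice (R : numDomainType) :=
  {E of GRing.Lmodule R E & Lmodule_isVectorLattice R E}.

(* The lattice modulus x \/ -x, as opposed to the norm `|x| : R. *)
Definition vabs (R : numDomainType) (E : vectorLatticeType R) (x : E) : E :=
  vjoin x (- x).

HB.mixin Record CompleteNormedModule_isBanachLattice (R : realType) E
    & CompleteNormedModule R E & VectorLattice R E := {
  vabs_norm_le : forall x y : E, vle (vabs x) (vabs y) -> `|x| <= `|y|
}.

#[short(type="banachLatticeType")]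
HB.structure Definition BanachLattice (R : realType) :=
  {E of CompleteNormedModule R E & VectorLattice R E
      & CompleteNormedModule_isBanachLattice R E}.

Definition weakly_null (R : realType) (E : normedModType R) (u : nat -> E) :=
  forall f : {linear E -> R^o}, continuous f -> f (u n) @[n --> \oo] --> (0 : R^o).

Section BanachLatticeSets.
Context {R : realType} {E : banachLatticeType R}.

Definition disjoint_seq (u : nat -> E) :=
  forall m n : nat, m <> n -> vmeet (vabs (u m)) (vabs (u n)) = 0.

Definition solid_hull (A : set E) : set E :=
  [set y | exists2 x, A x & vle (vabs y) (vabs x)].

Definition disjointly_weakly_compact (A : set E) :=
  bounded_set A /\
  forall u : nat -> E, (forall n, solid_hull A (u n)) -> disjoint_seq u ->
    weakly_null u.

Definition order_bounded (A : set E) :=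
  exists a b : E, forall x, A x -> vle a x /\ vle x b.

End BanachLatticeSets.

Section Operators.
Context {R : realType} {E : banachLatticeType R} {X : completeNormedModType R}.

Definition DW_compact (T : E -> X) :=
  forall A : set E, disjointly_weakly_compact A -> precompact (T @` A).

Definition AM_compact (T : E -> X) :=
  forall A : set E, order_bounded A -> precompact (T @` A).

Definition dunford_pettis (T : E -> X) :=
  forall u : nat -> E, weakly_null u -> `|T (u n)| @[n --> \oo] --> (0 : R).

Definition almost_dunford_pettis (T : E -> X) :=
  forall u : nat -> E, disjoint_seq u -> weakly_null u ->
    `|T (u n)| @[n --> \oo] --> (0 : R).

End Operators.

(* Main.v *)
Require Import Defs.
From HB Require Import structures.
From mathcomp Require Import all_boot all_order all_algebra.
From mathcomp Require Import all_classical all_reals all_analysis.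
From mathcomp Require Import lra ring.

(* The gliding hump of [diagonal_cvg0], the Schur property of l^1, carries the
   implication from DW-compact to Dunford-Pettis.  For a functional [f] and a
   disjoint sequence [u], the components of the modulus of [f] carried by the ideals
   generated by the [u k] have sums bounded by a multiple of the norm.  Hahn-Banach
   turns them into functionals [g k] with the same bound and with
   [`|f (u k)| <= g k (x k)] whenever [|u k| <= |x k|].  If the [x k] are taken from
   a weakly null sequence, the gliding hump gives [g k (x k) --> 0]; so disjoint
   sequences in the solid hull of a weakly null sequence are weakly null, [T] maps
   that sequence into a compact set, and a weakly null sequence with relatively
   compact range is norm null.  Order bounded sets are the case of a constant
   sequence [x].
   Conversely, if [T] sends the disjoint sequences of a solid bounded set to norm
   null sequences, then up to [e] it only sees the part of that set lying in an order
   interval [[- w, w]], whose image is relatively compact by AM-compactness. *)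

Set Implicit Arguments.
Unset Strict Implicit.
Unset Printing Implicit Defensive.

Import Order.TTheory GRing.Theory Num.Theory.
Import numFieldNormedType.Exports.
Local Open Scope classical_set_scope.
Local Open Scope ring_scope.

(** * Vector lattices *)

Arguments vle_trans {R s} [y x z] : rename.
Arguments vle_addr {R s} [x y] z : rename.
Arguments vle_scale0 {R s} [a x] : rename.
Arguments vle_refl {R s} x : rename.

Section VectorLatticeTheory.
Context {R : realFieldType} {E : vectorLatticeType R}.
Implicit Types (x y z a b : E) (t s : R).

Lemma vle_addl z x y : vle x y -> vle (z + x) (z + y).
Proof. by rewrite !(addrC z); exact: vle_addr. Qed.

Lemma vle_add2 x y z w : vle x y -> vle z w -> vle (x + z) (y + w).
Proof. by move=> xy zw; apply: vle_trans (vle_addr _ xy) (vle_addl _ zw). Qed.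

Lemma vle_addr0 x y : vle 0 y -> vle x (x + y).
Proof. by move=> y0; rewrite -{1}(addr0 x); exact: vle_addl. Qed.

Lemma vle_subr_addr x y z : vle (x - y) z = vle x (z + y).
Proof.
by apply/idP/idP => /vle_addr; [move=> /(_ y)|move=> /(_ (- y))];
  rewrite ?subrK ?addrK.
Qed.

Lemma vle_subl_addr x y z : vle x (z - y) = vle (x + y) z.
Proof. by rewrite -[y in RHS]opprK vle_subr_addr. Qed.

Lemma vle_sub0 x y : vle 0 (y - x) = vle x y.
Proof. by rewrite vle_subl_addr add0r. Qed.

Lemma vle_opp x y : vle x y -> vle (- y) (- x).
Proof. by rewrite -vle_sub0 -(vle_sub0 (- y)) opprK addrC. Qed.

Lemma vle_scale t x y : 0 <= t -> vle x y -> vle (t *: x) (t *: y).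
Proof.
by move=> t0; rewrite -vle_sub0 -(vle_sub0 (t *: x)) -scalerBr; exact: vle_scale0.
Qed.

Lemma vle_scaler t s x : t <= s -> vle 0 x -> vle (t *: x) (s *: x).
Proof.
by move=> ts x0; rewrite -vle_sub0 -scalerBl; apply: vle_scale0; rewrite ?subr_ge0.
Qed.

Lemma vle_joinEl x y : vle x (vjoin x y).
Proof. by have := vle_refl (vjoin x y); rewrite vle_joinl => /andP[]. Qed.

Lemma vle_joinEr x y : vle y (vjoin x y).
Proof. by have := vle_refl (vjoin x y); rewrite vle_joinl => /andP[]. Qed.

Lemma vle_meetEl x y : vle (vmeet x y) x.
Proof. by have := vle_refl (vmeet x y); rewrite vle_meetr => /andP[]. Qed.

Lemma vle_meetEr x y : vle (vmeet x y) y.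
Proof. by have := vle_refl (vmeet x y); rewrite vle_meetr => /andP[]. Qed.

Lemma vle_eq x y : vle x y -> vle y x -> x = y.
Proof. by move=> xy yx; apply: vle_anti; rewrite xy. Qed.

Lemma vabs_le x y : vle (vabs x) y = vle x y && vle (- x) y.
Proof. exact: vle_joinl. Qed.

Lemma vle_abs x : vle x (vabs x). Proof. exact: vle_joinEl. Qed.

Lemma vle_absN x : vle (- x) (vabs x). Proof. exact: vle_joinEr. Qed.

Lemma vge_absN x : vle (- vabs x) x.
Proof. by rewrite -[x in X in vle _ X]opprK; apply/vle_opp/vle_absN. Qed.

Lemma vabs_ge0 x : vle 0 (vabs x).
Proof.
have := vle_add2 (vle_abs x) (vle_absN x).
rewrite subrr => /(vle_scale0 (ltac:(lra) : 0 <= 2^-1 :> R)).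
by rewrite scalerDr -scalerDl (_ : 2^-1 + 2^-1 = 1 :> R) ?scale1r//; lra.
Qed.

Lemma vabsN x : vabs (- x) = vabs x.
Proof.
by apply: vle_eq; rewrite vabs_le ?opprK ?vle_abs ?vle_absN // -{1}(opprK x) vle_absN.
Qed.

Lemma vabs_id x : vle 0 x -> vabs x = x.
Proof.
move=> x0; apply: vle_eq (vle_abs x); rewrite vabs_le vle_refl /=.
by apply: (vle_trans _ x0); rewrite -oppr0; exact: vle_opp.
Qed.

Lemma vabs_abs x : vabs (vabs x) = vabs x.
Proof. exact/vabs_id/vabs_ge0. Qed.

Lemma vabs0 : vabs (0 : E) = 0. Proof. exact/vabs_id/vle_refl. Qed.

Lemma vabs_triangle x y : vle (vabs (x + y)) (vabs x + vabs y).
Proof. by rewrite vabs_le opprD !vle_add2 ?vle_abs ?vle_absN. Qed.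

Lemma vabs_scale t x : vle (vabs (t *: x)) (`|t| *: vabs x).
Proof.
rewrite vabs_le; case: (ger0P t) => t0.
  by rewrite -scalerN !vle_scale ?vle_abs ?vle_absN.
have Nt0 : 0 <= - t by rewrite oppr_ge0 ltW.
by rewrite -scaleNr vle_scale ?vle_abs// -[t in X in vle X _]opprK scaleNr -scalerN
  vle_scale ?vle_absN.
Qed.

Lemma vabs_sum (I : Type) (r : seq I) (P : pred I) (u : I -> E) :
  vle (vabs (\sum_(i <- r | P i) u i)) (\sum_(i <- r | P i) vabs (u i)).
Proof.
elim/big_rec2 : _ => [|i x y _ xy]; first by rewrite vabs0 vle_refl.
exact: vle_trans (vabs_triangle _ _) (vle_addl _ xy).
Qed.

Lemma vle0_sum (I : Type) (r : seq I) (P : pred I) (u : I -> E) :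
  (forall i, vle 0 (u i)) -> vle 0 (\sum_(i <- r | P i) u i).
Proof.
move=> u0; apply: (big_ind (fun z => vle 0 z)) => [|x y x0 y0|//]; first exact: vle_refl.
exact: vle_trans x0 (vle_addr0 _ y0).
Qed.

Lemma vle_meet2 x y z w : vle x y -> vle z w -> vle (vmeet x z) (vmeet y w).
Proof.
move=> xy zw; rewrite vle_meetr (vle_trans (vle_meetEl _ _) xy).
exact: vle_trans (vle_meetEr _ _) zw.
Qed.

Lemma vmeetC x y : vmeet x y = vmeet y x.
Proof. by apply: vle_eq; rewrite vle_meetr vle_meetEl vle_meetEr. Qed.

Lemma vmeet_ge0 x y : vle 0 x -> vle 0 y -> vle 0 (vmeet x y).
Proof. by rewrite vle_meetr => -> ->. Qed.

Lemma vmeet_le_eq0 x y z w : vle 0 x -> vle 0 z -> vle x y -> vle z w ->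
  vmeet y w = 0 -> vmeet x z = 0.
Proof.
move=> x0 z0 xy zw yw; apply: vle_eq; last exact: vmeet_ge0.
by rewrite -yw; exact: vle_meet2.
Qed.

Lemma vmeetDr x y z : vle 0 x -> vle 0 y -> vle 0 z ->
  vle (vmeet x (y + z)) (vmeet x y + vmeet x z).
Proof.
move=> x0 y0 z0; rewrite -vle_subr_addr vle_meetr !vle_subr_addr; apply/andP; split.
  exact: vle_trans (vle_meetEl _ _) (vle_addr0 _ (vmeet_ge0 _ _)).
rewrite [y + vmeet x z]addrC -vle_subr_addr vle_meetr !vle_subr_addr; apply/andP; split.
  exact: vle_trans (vle_meetEl _ _) (vle_addr0 _ _).
by rewrite addrC; exact: vle_meetEr.
Qed.

Lemma vmeet_sum0 x (u : nat -> E) n : vle 0 x -> (forall i, vle 0 (u i)) ->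
  (forall i, (i < n)%N -> vmeet x (u i) = 0) -> vmeet x (\sum_(i < n) u i) = 0.
Proof.
move=> x0 u0; elim: n => [|n IH] ux.
  by rewrite big_ord0; apply: vle_eq (vle_meetEr _ _) (vmeet_ge0 _ (vle_refl _)).
have S0 : vle 0 (\sum_(i < n) u i) by apply: vle0_sum => i; exact: u0.
rewrite big_ord_recr /=; apply: vle_eq.
  by have := vmeetDr x0 S0 (u0 n); rewrite IH ?ux ?addr0// => i /ltnW; exact: ux.
by apply: vmeet_ge0 => //; apply: vle_trans S0 (vle_addr0 _ (u0 n)).
Qed.

Lemma vmeet_scale t x y : 0 < t -> vmeet (t *: x) (t *: y) = t *: vmeet x y.
Proof.
move=> t0; have tn0 : t != 0 by rewrite gt_eqF.
apply: vle_eq; last by rewrite vle_meetr !vle_scale ?ltW ?vle_meetEl ?vle_meetEr.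
rewrite -[X in vle X _]scale1r -(mulfV tn0) -scalerA vle_scale ?ltW//.
have tV : 0 <= t^-1 by rewrite invr_ge0 ltW.
rewrite vle_meetr -[X in vle _ X && _]scale1r -[X in _ && vle _ X]scale1r.
by rewrite -(mulVf tn0) -!scalerA !vle_scale ?vle_meetEl ?vle_meetEr.
Qed.

(** [x + y - z] lies below both [x] and [y], hence below their infimum [0]. *)
Lemma vadd_disjoint_le x y z : vmeet x y = 0 -> vle x z -> vle y z -> vle (x + y) z.
Proof.
move=> xy xz yz; suff : vle (x + y - z) (vmeet x y).
  by rewrite xy vle_subr_addr add0r.
rewrite vle_meetr !vle_subr_addr; apply/andP; split; first exact: vle_addl.
by rewrite addrC; exact: vle_addl.
Qed.

Lemma vsum_disjoint_le (u : nat -> E) n z : (forall i, vle 0 (u i)) ->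
  (forall i j, i <> j -> vmeet (u i) (u j) = 0) ->
  vle 0 z -> (forall i, vle (u i) z) -> vle (\sum_(i < n) u i) z.
Proof.
move=> u0 uu z0 uz; elim: n => [|n IH]; first by rewrite big_ord0.
rewrite big_ord_recr /= vadd_disjoint_le// vmeetC vmeet_sum0// => i ni.
by apply: uu => ni'; rewrite ni' ltnn in ni.
Qed.

(** Truncation: [z1] is [z] cut to the interval from [- a] to [a]. The last two bounds keep both
    pieces in every ideal containing [z], for the subadditivity of [local_norm]. *)
Lemma riesz_decomposition z a b : vle 0 a -> vle 0 b -> vle (vabs z) (a + b) ->
  exists z1 z2, [/\ z = z1 + z2, vle (vabs z1) a, vle (vabs z2) b,
    vle (vabs z1) (vabs z) & vle (vabs z2) (vabs z)].
Proof.
move=> a0 b0; rewrite vabs_le => /andP[zab Nzab].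
have Na0 : vle (- a) 0 by rewrite -oppr0; exact: vle_opp.
pose z1 := vjoin (vmeet z a) (- a).
have z2_le w : vle 0 w -> vle z (a + w) -> vle (z - z1) w.
  move=> w0 zw; rewrite vle_subr_addr addrC -vle_subr_addr.
  apply: vle_trans (vle_joinEl _ _); rewrite vle_meetr !vle_subr_addr zw andbT.
  exact: vle_addr0.
have z2_ge w : vle w 0 -> vle w (z + a) -> vle w (z - z1).
  move=> w0 zw; rewrite vle_subl_addr addrC -vle_subl_addr vle_joinl.
  rewrite vle_subl_addr; apply/andP; split.
    apply: vle_trans (vle_meetEl z a); rewrite -[X in vle _ X]addr0; exact: vle_addl.
  by rewrite vle_subl_addr addrC -vle_subl_addr opprK.
exists z1, (z - z1); split; first by rewrite addrC subrK.
- rewrite vabs_le vle_joinl vle_meetEr (vle_trans Na0 a0)//=.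
  by rewrite -[X in vle _ X]opprK; apply/vle_opp/vle_joinEr.
- rewrite vabs_le z2_le//=; rewrite -[b]opprK; apply/vle_opp/z2_ge.
    by rewrite -oppr0; exact: vle_opp.
  by rewrite -vle_subr_addr -opprD [b + a]addrC -[z]opprK; exact: vle_opp.
- rewrite vabs_le vle_joinl (vle_trans (vle_meetEl _ _) (vle_abs _)).
  rewrite (vle_trans Na0 (vabs_ge0 _))/=.
  rewrite -[vabs z]opprK; apply/vle_opp.
  have Nz0 : vle (- vabs z) 0 by rewrite -oppr0; apply/vle_opp/vabs_ge0.
  apply: vle_trans (vle_joinEl _ _); rewrite vle_meetr vge_absN.
  exact: vle_trans Nz0 a0.
- rewrite vabs_le z2_le ?vabs_ge0//=; last first.
    by apply: vle_trans (vle_abs z) _; rewrite addrC; exact: vle_addr0.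
  rewrite -[vabs z]opprK; apply/vle_opp/z2_ge.
    by rewrite -oppr0; exact/vle_opp/vabs_ge0.
  exact: vle_trans (vge_absN z) (vle_addr0 _ a0).
Qed.

(** Positive and negative parts are disjoint: [z^- - d] majorizes [0] and also [z^- - z^+ = - z], so
    it majorizes [z^-]. *)
Lemma vmeet_pos_neg z d : vle d (vjoin z 0) -> vle d (vjoin (- z) 0) -> vle d 0.
Proof.
move=> dz dNz; suff : vle (vjoin (- z) 0) (vjoin (- z) 0 - d).
  by rewrite vle_subl_addr -vle_sub0 opprD addrA subrr vle_sub0.
rewrite [vle (vjoin (- z) 0) (_ - d)]vle_joinl vle_sub0 dNz andbT.
rewrite vle_subl_addr addrC vle_subr_addr.
apply: vle_trans dz _; rewrite vle_joinl; apply/andP; split.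
  by rewrite -vle_subr_addr subrr; exact: vle_joinEr.
by rewrite -vle_subr_addr sub0r; exact: vle_joinEl.
Qed.

(** The infimum [d] of [v] and [w] satisfies [d <= t d <= (t y - t s x)^+ <= (t y - x)^+], so it
    lies below both the positive and the negative part of [x - t y]. *)
Lemma vpos_disjoint x y v w t s : vle 0 v -> vle 0 w -> vle 0 x -> 1 <= t -> 1 <= t * s ->
  vle v (vjoin (x - t *: y) 0) -> vle w (vjoin (y - s *: x) 0) -> vmeet v w = 0.
Proof.
move=> v0 w0 x0 t1 ts vx wy; apply: vle_eq; last exact: vmeet_ge0.
have d0 := vmeet_ge0 v0 w0; have t0 : 0 <= t by exact: le_trans t1.
apply: (@vmeet_pos_neg (x - t *: y)); first exact: vle_trans (vle_meetEl _ _) vx.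
apply: (@vle_trans _ _ (t *: vmeet v w)).
  by rewrite -[X in vle X _]scale1r; exact: vle_scaler.
apply: (vle_trans (vle_scale t0 (vle_meetEr v w))).
apply: (vle_trans (vle_scale t0 wy)).
have tn0 : t != 0 by rewrite gt_eqF// (lt_le_trans _ t1).
rewrite -[X in vle _ X]scale1r -(mulfV tn0) -scalerA; apply: vle_scale => //.
have tV : 0 <= t^-1 by rewrite invr_ge0.
rewrite vle_joinl; apply/andP; split; last first.
  by apply: vle_scale0 => //; exact: vle_joinEr.
apply: (@vle_trans _ _ (t^-1 *: (- (x - t *: y)))); last exact/vle_scale/vle_joinEl.
rewrite opprB scalerBr scalerA mulVf// scale1r vle_addl//; apply: vle_opp.
by apply: vle_scaler => //; rewrite -(ler_pM2l (lt_le_trans ltr01 t1)) mulfV.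
Qed.

End VectorLatticeTheory.

(** * Hahn-Banach *)

Lemma linear_of (R : realType) (V : lmodType R) (f : V -> R^o) :
  (forall t x y, f (t *: x + y) = t * f x + f y) ->
  exists g : {linear V -> R^o}, forall x, g x = f x.
Proof.
move=> flin.
pose g : {linear V -> R^o} := HB.pack f (GRing.isLinear.Build R V R^o *:%R f flin).
by exists g.
Qed.

Section HahnBanach.
Context {R : realType} {V : lmodType R} (p : V -> R) (x0 : V).
Hypothesis p_add : forall x y, p (x + y) <= p x + p y.
Hypothesis p_scale : forall t x, 0 <= t -> p (t *: x) = t * p x.

(* Graphs of linear functionals on subspaces containing [x0] that are dominated
   by [p] and touch it at [x0].  The third clause is vacuous on the empty set, so
   that the union of the empty chain qualifies in Zorn's lemma; domination makes
   such a set functional since [p 0 = 0]. *)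
Let dominated_graph (G : set (V * R)) :=
  [/\ forall u v t, G u -> G v -> G (u.1 + t *: v.1, u.2 + t * v.2),
      forall u, G u -> u.2 <= p u.1
    & forall u, G u -> G (x0, p x0)].

Let p0 : p 0 = 0.
Proof. by rewrite -(scale0r (0 : V)) p_scale// mul0r. Qed.

Let line_dominated : dominated_graph [set (a *: x0, a * p x0) | a in setT].
Proof.
split=> [_ _ t [a _ <-] [b _ <-]|_ [a _ <-]|_ _] /=.
- by exists (a + t * b) => //; rewrite scalerDl mulrDl scalerA mulrA.
- case: (lerP 0 a) => a0; first by rewrite p_scale.
  (* For [a < 0], subadditivity at [a x0 + (- a) x0 = 0] gives [- p ((- a) x0) <= p (a x0)]. *)
  have := p_add (a *: x0) ((- a) *: x0); rewrite scaleNr subrr p0 -scaleNr.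
  by rewrite [p (- a *: _)]p_scale; [nra|lra].
- by exists 1 => //; rewrite scale1r mul1r.
Qed.

Let dominated_graph_scale G u t : dominated_graph G -> G u -> G (t *: u.1, t * u.2).
Proof.
move=> [Glin _ _] Gu; have := Glin _ _ t (Glin _ _ (-1) Gu Gu) Gu.
by rewrite /= scaleN1r mulN1r !subrr !add0r.
Qed.

(** One-dimensional extension: domination asks the value [c] at [z] to lie above every
    [u.2 - p (u.1 - z)] and below every [p (v.1 + z) - v.2]; the supremum of the former works by
    [cut]. *)
Let dominated_graph_extend G z : dominated_graph G -> G !=set0 ->
  exists2 G', dominated_graph G' & G `<=` G' /\ exists c, G' (z, c).
Proof.
move=> DG [u0 Gu0]; have [Glin Gp Gx0] := DG.
have cut u v : G u -> G v -> u.2 - p (u.1 - z) <= p (v.1 + z) - v.2.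
  move=> Gu Gv; have := Gp _ (Glin _ _ 1 Gu Gv); rewrite /= scale1r mul1r.
  have := p_add (u.1 - z) (v.1 + z); rewrite addrACA addNr addr0; lra.
pose S := [set u.2 - p (u.1 - z) | u in G].
pose c := sup S.
have cge u : G u -> u.2 - p (u.1 - z) <= c.
  move=> Gu; apply: ub_le_sup; last by exists u.
  by exists (p (u0.1 + z) - u0.2) => _ [v Gv <-]; exact: cut.
have cle v : G v -> c <= p (v.1 + z) - v.2.
  move=> Gv; apply: ge_sup; first by exists (u0.2 - p (u0.1 - z)); exists u0.
  by move=> _ [u Gu <-]; exact: cut.
exists [set w | exists u a, G u /\ w = (u.1 + a *: z, u.2 + a * c)]; last first.
  split=> [u Gu|].
    by exists u, 0; split => //; rewrite scale0r mul0r !addr0 -surjective_pairing.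
  exists c, (0 *: u0.1, 0 * u0.2), 1; split; first exact: dominated_graph_scale.
  by rewrite /= scale0r mul0r !add0r scale1r mul1r.
split=> [_ _ t [u [a [Gu ->]]] [v [b [Gv ->]]]|_ [u [a [Gu ->]]]|_ [u [a [Gu _]]]] /=.
- exists (u.1 + t *: v.1, u.2 + t * v.2), (a + t * b); split; first exact: Glin.
  by rewrite /= scalerDl scalerDr scalerA addrACA; congr (_, _); ring.
(* For [a > 0] the upper bound on [c] is used at [u / a], for [a < 0] the lower bound at
   [u / (- a)]. *)
- case: (ltrgt0P a) => [a0|a0|->]; last by rewrite scale0r mul0r !addr0 Gp.
    have /= := cle _ (dominated_graph_scale a^-1 DG Gu).
    rewrite -(ler_pM2l a0) mulrBr -(p_scale _ (ltW a0)) scalerDr scalerA mulrA.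
    by rewrite !mulfV ?gt_eqF// scale1r mul1r; lra.
  have b0 : 0 < - a by lra.
  have /= := cge _ (dominated_graph_scale (- a)^-1 DG Gu).
  rewrite -(ler_pM2l b0) mulrBr -(p_scale _ (ltW b0)) scalerBr scalerA mulrA.
  by rewrite !mulfV ?gt_eqF// scale1r mul1r scaleNr opprK; lra.
- exists (x0, p x0), 0; split; first exact: Gx0 Gu.
  by rewrite scale0r mul0r !addr0.
Qed.

(** A maximal dominated graph, given by Zorn's lemma, is total by the extension step and
    single-valued by domination. *)
Theorem hahn_banach : exists f : {linear V -> R^o},
  (forall x, f x <= p x) /\ f x0 = p x0.
Proof.
have [G [DG Gmax]] : exists G, dominated_graph G /\
    forall B, G `<` B -> ~ dominated_graph B.
  apply: Zorn_bigcup => F FD Ftot; split.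
  - move=> u v t [A FA Au] [B FB Bv].
    have [AB|BA] := Ftot _ _ FA FB.
      by exists B => //; have [Blin _ _] := FD _ FB; apply: Blin => //; exact: AB.
    by exists A => //; have [Alin _ _] := FD _ FA; apply: Alin => //; exact: BA.
  - by move=> u [A FA Au]; have [_ + _] := FD _ FA; exact.
  - by move=> u [A FA Au]; exists A => //; have [_ _ Ax0] := FD _ FA; exact: Ax0 Au.
(* The empty graph is not maximal: it is strictly contained in the line through [x0]. *)
have G0 : G !=set0.
  apply/set0P/eqP => G0; apply: (Gmax _ _ line_dominated); rewrite G0.
  by split=> // /(_ (0 *: x0, 0 * p x0)); apply; exists 0.
have [Glin Gp Gx0] := DG.
have total x : exists r, G (x, r).
  have [G' DG' [GG' [c G'c]]] := dominated_graph_extend x DG G0.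
  exists c; apply: contrapT => Gc; apply: (Gmax G') => //; split => //.
  by move=> /(_ _ G'c).
(* Both [(0, r - s)] and [(0, s - r)] lie in [G], and [p 0 = 0]. *)
have uniq x r s : G (x, r) -> G (x, s) -> r = s.
  move=> Gr Gs; have := Gp _ (Glin _ _ (-1) Gr Gs).
  have := Gp _ (Glin _ _ (-1) Gs Gr); rewrite /= !scaleN1r !subrr p0; lra.
pose f x := projT1 (cid (total x)).
have Gf x : G (x, f x) by rewrite /f; case: cid.
have [|g gf] := @linear_of R V f.
  move=> t x y; apply: uniq (Gf _) _.
  by have := Glin _ _ t (Gf y) (Gf x); rewrite /= addrC [f y + _]addrC.
exists g; split=> [x|]; rewrite gf; first exact: Gp (Gf x).
by case: G0 => u /Gx0; apply: uniq; exact: Gf.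
Qed.

End HahnBanach.

Lemma norming_functional (R : realType) (V : normedModType R) (x : V) :
  exists f : {linear V -> R^o}, (forall y, `|f y| <= `|y|) /\ f x = `|x|.
Proof.
have [||f [fle fx]] := @hahn_banach R V (fun y => `|y|) x.
- exact: ler_normD.
- by move=> t y t0; rewrite normrZ ger0_norm.
exists f; split => // y; rewrite ler_norml fle andbT.
by have := fle (- y); rewrite linearN normrN /=; lra.
Qed.

(** * Summable sequences of functionals *)

Lemma not_near_infty (P : nat -> Prop) : ~ (\forall k \near \oo, P k) ->
  forall K, exists2 k, (K <= k)%N & ~ P k.
Proof.
move=> nP K; apply: contrapT => nk; apply: nP; exists K => //= k Kk.
by apply: contrapT => nPk; apply: nk; exists k.
Qed.

Lemma near_infty_all (P : nat -> nat -> Prop) M :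
  (forall m, \forall k \near \oo, P m k) ->
  \forall k \near \oo, forall m, (m < M)%N -> P m k.
Proof.
move=> nP; elim: M => [|M IH]; first exact: nearW.
near=> k => m; rewrite ltnS leq_eqVlt => /orP[/eqP ->|].
  by near: k; exact: nP.
by move: m; near: k; exact: IH.
Unshelve. all: by end_near. Qed.

Lemma bounded_series_tail (R : realType) (a : nat -> R) C e : (forall j, 0 <= a j) ->
  (forall N, \sum_(j < N) a j <= C) -> 0 < e ->
  exists K, forall L N, (K <= L)%N -> \sum_(L <= j < N) a j <= e.
Proof.
move=> a0 aC e0; pose S := range (fun N => \sum_(j < N) a j).
have hS : has_sup S.
  by split; [exists (\sum_(j < 0) a j); exists 0%N|exists C => _ [N _ <-]].
have [_ [K _ <-] SK] := sup_adherent e0 hS.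
exists K => L N KL; case: (leqP N L) => [NL|/ltnW LN]; first by rewrite big_geq// ltW.
have : \sum_(j < N) a j <= sup S by apply: (sup_upper_bound hS); exists N.
rewrite -(big_mkord xpredT) (big_cat_nat (n := K)) ?(leq_trans KL)//= big_mkord.
rewrite (big_cat_nat (n := L))//=.
have : 0 <= \sum_(K <= j < L) a j by exact: sumr_ge0.
by move: SK; lra.
Qed.

Lemma linear_bound_continuous (R : realType) (V W : normedModType R)
    (f : {linear V -> W}) C : (forall x, `|f x| <= C * `|x|) -> continuous f.
Proof.
move=> fC; apply/bounded_linear_continuous/linear_boundedP.
exists C; rewrite num_real; split => // r Cr x.
by apply: le_trans (fC x) _; rewrite ler_wpM2r// ltW.
Qed.

Lemma continuous_linear_bound (R : realType) (V W : normedModType R)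
    (f : {linear V -> W}) : continuous f ->
  exists2 C, 0 <= C & forall x, `|f x| <= C * `|x|.
Proof.
move=> /linear_bounded_continuous/linear_boundedP/pinfty_ex_gt0[C C0 fC].
by exists C => //; exact: ltW.
Qed.

Section SummableFunctionals.
Context {R : realType} {V : normedModType R}.
Variables (g : nat -> {linear V -> R^o}) (C : R).
Hypothesis g_bound : forall N x, \sum_(k < N) `|g k x| <= C * `|x|.

(** The series converges absolutely at each [x], and its limit inherits linearity and the bound [C].
    The gliding hump takes for [c] the indicator of a set of indices. *)
Lemma functional_series (c : nat -> R) : (forall j, `|c j| <= 1) ->
  exists h : {linear V -> R^o}, (forall x, `|h x| <= C * `|x|) /\
    forall x, \sum_(0 <= j < N) c j * g j x @[N --> \oo] --> h x.
Proof.
move=> c1; pose s x := series (fun j => c j * g j x : R^o).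
have sle N x : \sum_(0 <= j < N) `|c j * g j x| <= C * `|x|.
  apply: le_trans (g_bound N x); rewrite big_mkord; apply: ler_sum => j _.
  by rewrite normrM ler_piMl.
have scvg x : cvgn (s x).
  apply: normed_cvg; apply: nondecreasing_is_cvgn.
    by apply: nondecreasing_series => j _ _; exact: normr_ge0.
  by exists (C * `|x|) => _ [N _ <-]; exact: sle.
pose h x : R^o := limn (s x).
have sh x : s x @ \oo --> h x by exact: scvg.
have [|h' h'E] := @linear_of R V h.
  move=> t x y; apply: cvg_lim => //.
  have -> : s (t *: x + y) = (fun N => t * s x N + s y N).
    apply/funext => N; rewrite /s /series /= mulr_sumr -big_split /=.
    by apply: eq_bigr => j _; rewrite linearP /= /GRing.scale /=; ring.
  apply: cvgD (sh y); exact: (@cvgMl_tmp _ _ _ _ (s x) t (h x) (sh x)).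
exists h'; split=> x; rewrite h'E; last exact: sh.
have ch : `|s x N| @[N --> \oo] --> `|h x| by apply: cvg_norm; exact: sh.
rewrite -(cvg_lim _ ch)//.
apply: limr_le; first exact: cvgP ch.
apply: nearW => N; exact: le_trans (ler_norm_sum _ _ _) (sle N x).
Qed.

Lemma functional_le x k : `|g k x| <= C * `|x|.
Proof.
apply: le_trans (g_bound k.+1 x); rewrite big_ord_recr /= lerDr.
by apply: sumr_ge0 => j _; exact: normr_ge0.
Qed.

Lemma functional_tail x e : 0 < e ->
  exists K, forall L N, (K <= L)%N -> \sum_(L <= j < N) `|g j x| <= e.
Proof. by apply: (bounded_series_tail (C := C * `|x|)). Qed.

Lemma functional_cvg0 x : g k x @[k --> \oo] --> (0 : R^o).
Proof.
apply/cvgr0Pnorm_le => e /functional_tail => /(_ x)[K tailK]; exists K => // k /= Kk.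
by have := tailK k k.+1 Kk; rewrite big_nat1.
Qed.

(* A gliding hump, as in the proof that weakly null sequences in l^1 are null:
   if the conclusion fails, a subseries of [g] has a sum that does not tend to
   [0] along [x]. *)
Lemma diagonal_cvg0 (x : nat -> V) (n : nat -> nat) : weakly_null x ->
  g k (x (n k)) @[k --> \oo] --> (0 : R^o).
Proof.
move=> xnull; apply/cvgr0Pnorm_lt => e e0; apply: contrapT => /not_near_infty bad.
have e4 : 0 < e / 4 by rewrite divr_gt0.
have gx0 j : g j (x m) @[m --> \oo] --> (0 : R^o).
  by apply: xnull; apply: (linear_bound_continuous (C := C)) => y; exact: functional_le.
have head K : \forall m \near \oo, \sum_(0 <= j < K) `|g j (x m)| <= e / 4.
  have K0 : 0 < e / 4 / K.+1%:R by rewrite divr_gt0.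
  have small j : \forall m \near \oo, `|g j (x m)| <= e / 4 / K.+1%:R.
    exact: cvgr0_norm_le (gx0 j) _ K0.
  apply: filterS (near_infty_all K small) => m gm; rewrite big_mkord.
  apply: (@le_trans _ _ (\sum_(j < K) (e / 4 / K.+1%:R))).
    by apply: ler_sum => j _; exact: gm.
  rewrite sumr_const card_ord -[X in X <= _]mulr_natr -mulrA ler_piMr ?(ltW e4)//.
  by rewrite mulrC ler_pdivrMr// mul1r ler_nat.
(* A hump at [k >= K]: at [x (n k)] the functional [g k] has size at least [e], while those before
   [K] and those from [kK.2] on contribute at most [e / 4] each. *)
have step K : exists kK : nat * nat, [/\ (K <= kK.1 < kK.2)%N, (K <= n kK.1)%N,
    e <= `|g kK.1 (x (n kK.1))|,
    \sum_(0 <= j < K) `|g j (x (n kK.1))| <= e / 4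
  & forall N, \sum_(kK.2 <= j < N) `|g j (x (n kK.1))| <= e / 4].
  have [M _ headM] := head K.
  (* For each fixed [m] this holds for late [k], so a late bad index [k] must have [n k] large. *)
  have far m : \forall k \near \oo, `|g k (x m)| < e.
    exact: cvgr0_norm_lt (functional_cvg0 (x m)) _ e0.
  have [K1 _ farK1] := near_infty_all (maxn K M) far.
  have [k Kk /negP] := bad (maxn K K1); rewrite -leNgt => ek.
  have nk : (maxn K M <= n k)%N.
    rewrite leqNgt; apply/negP => nk; have K1k := leq_trans (leq_maxr _ _) Kk.
    by have := farK1 k K1k _ nk; rewrite ltNge ek.
  have [K' tailK'] := functional_tail (x (n k)) e4.
  exists (k, maxn k.+1 K'); split=> //=.
  - by rewrite (leq_trans (leq_maxl _ _) Kk) leq_maxl.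
  - exact: leq_trans (leq_maxl _ _) nk.
  - by apply: headM; exact: leq_trans (leq_maxr _ _) nk.
  - by move=> N; apply: tailK'; exact: leq_maxr.
have [kK kKP] := choice step.
(* The hump [k i] lies in the block from [a i] to [a i.+1]; the coefficients [c] below select
   exactly one index per block. *)
pose a := fix a i := if i is i'.+1 then (kK (a i')).2 else 0%N.
pose k i := (kK (a i)).1.
have ak i : (a i <= k i < a i.+1)%N by have [] := kKP (a i).
have a_mono i j : (i <= j)%N -> (a i <= a j)%N.
  apply: (homo_leq (r := leq)) => //; first exact: leq_trans.
  by move=> l; have /andP[al la] := ak l; exact/ltnW/(leq_ltn_trans al).
have a_ge i : (i <= a i)%N.
  elim: i => // i /leq_ltn_trans; apply.
  by have /andP[al la] := ak i; exact: leq_ltn_trans al la.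
pose c j : R := (`[< exists i, j = k i >])%:R.
have c1 j : `|c j| <= 1 by rewrite /c; case: asbool; rewrite ?normr1 ?normr0.
have ck i : c (k i) = 1 by rewrite /c (_ : `[< _ >]) //; apply/asboolP; exists i.
have c0 i j : (a i <= j < a i.+1)%N -> j != k i -> c j = 0.
  move=> /andP[aij jai] /eqP jk; rewrite /c; case: asboolP => // -[l jl].
  have /andP[alj jal] := ak l; rewrite -jl in alj jal.
  case: (ltngtP i l) => [il|li|il]; last by rewrite il in jk.
    by have := leq_trans jai (leq_trans (a_mono _ _ il) alj); rewrite ltnn.
  by have := leq_trans jal (leq_trans (a_mono _ _ li) aij); rewrite ltnn.
have [h [hC hsum]] := functional_series c1.
have hx0 : h (x m) @[m --> \oo] --> (0 : R^o).
  by apply: xnull; exact: linear_bound_continuous hC.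
(* Since [M <= a M <= n (k M)], [h] is smaller than [e / 4] at the [M]-th hump. Head, tail, [h] and
   the truncation of its series cost at most [e / 4] each, the last two strictly less, so the hump
   is below [e]. *)
have [M _ hM] := cvgr0_norm_lt _ hx0 _ e4.
have [_ nk gk headk tailk] := kKP (a M); rewrite -/(k M) in nk gk headk tailk.
have /andP[aM Ma] := ak M.
have := hM (n (k M)) (leq_trans (a_ge M) nk).
have := hsum (x (n (k M))); move/cvgrPdist_lt => /(_ _ e4)[N0 _ /(_ (maxn N0 (a M.+1)))].
set N := maxn _ _; set z := x (n (k M)) => /(_ (leq_maxl _ _)).
have splitE : \sum_(0 <= j < N) c j * g j z = \sum_(0 <= j < a M) c j * g j z +
    (g (k M) z + \sum_(a M.+1 <= j < N) c j * g j z).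
  rewrite (big_cat_nat (n := a M))//=; last first.
    by rewrite (leq_trans (a_mono _ _ (leqnSn M)))// leq_maxr.
  rewrite [X in _ + X = _](big_cat_nat (n := a M.+1)) ?a_mono ?leq_maxr//.
  congr (_ + (_ + _)); rewrite (bigD1_seq (k M)) ?mem_index_iota ?iota_uniq//=.
  rewrite ck mul1r big1_seq ?addr0// => j /andP[jk]; rewrite mem_index_iota => aj.
  by rewrite (c0 M)// mul0r.
have sub_le p q : `|\sum_(p <= j < q) c j * g j z| <= \sum_(p <= j < q) `|g j z|.
  apply: le_trans (ler_norm_sum _ _ _) _; apply: ler_sum => j _.
  by rewrite normrM ler_piMl.
have := le_trans (sub_le _ _) headk; have := le_trans (sub_le _ _) (tailk N).
rewrite splitE; move: gk; rewrite -/z.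
set s1 := \sum_(_ <= j < a M) _; set s2 := \sum_(_ <= j < N) _.
move: (g (k M) z) (h z) s1 s2 => u v s1 s2.
rewrite !ltr_norml !ler_norml ler_normr.
by move=> /orP[]; lra.
Qed.

End SummableFunctionals.

(** The gliding hump acts as a uniform boundedness principle: if [|x (n k)| > 2 ^ k], norming
    functionals scaled by [2 ^ (- k)] have summable norms, yet exceed [1] at [x (n k)]. *)
Lemma weakly_null_bounded (R : realType) (V : normedModType R) (x : nat -> V) :
  weakly_null x -> exists M, forall n, `|x n| <= M.
Proof.
move=> xnull; apply: contrapT => unbounded.
have large k : exists n, 2 ^+ k < `|x n|.
  apply: contrapT => small; apply: unbounded; exists (2 ^+ k) => m.
  by rewrite leNgt; apply/negP => xm; apply: small; exists m.
have [n nP] := choice large.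
have scaled k : exists g : {linear V -> R^o},
    (forall y, `|g y| <= 2^-1 ^+ k * `|y|) /\ g (x (n k)) = 2^-1 ^+ k * `|x (n k)|.
  have [f [f1 fx]] := norming_functional (x (n k)).
  have [|g gE] := @linear_of R V (fun y => 2^-1 ^+ k * f y).
    by move=> t y z; rewrite linearP /= /GRing.scale /=; ring.
  exists g; split=> [y|]; rewrite gE ?fx// normrM ger0_norm ?exprn_ge0//.
  by rewrite ler_wpM2l ?exprn_ge0.
have [g gP] := choice scaled.
have g_bound N y : \sum_(k < N) `|g k y| <= 2 * `|y|.
  apply: (@le_trans _ _ (\sum_(k < N) 2^-1 ^+ k * `|y|)).
    by apply: ler_sum => k _; have [] := gP k.
  rewrite -mulr_suml ler_wpM2r//.
  suff -> : \sum_(k < N) 2^-1 ^+ k = 2 - 2 * 2^-1 ^+ N :> R.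
    by rewrite gerBl mulr_ge0// exprn_ge0.
  elim: N => [|N IH]; first by rewrite big_ord0 expr0; lra.
  by rewrite big_ord_recr /= IH exprS; lra.
have [K _ /(_ K (leqnn K))] := cvgr0_norm_lt _ (diagonal_cvg0 g_bound n xnull) _ ltr01.
rewrite (gP K).2 ger0_norm ?mulr_ge0 ?exprn_ge0// ltNge => /negP; apply.
rewrite exprVn -(ler_pM2l (exprn_gt0 K (ltr0n R 2))) mulrA mulfV ?mul1r ?mulr1 ?ltW//.
Qed.

(** * Compactness and disjoint sequences *)

(** Move each point of an ultrafilter on [closure S] to a nearby point of [K]. The image filter
    clusters at some [y], so the ultrafilter contains the ball of radius [e] about [y]; it is
    Cauchy, hence convergent. *)
Lemma precompact_approx (R : realType) (X : completeNormedModType R) (S : set X) :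
  (forall e : R, 0 < e -> exists2 K, precompact K &
     forall x, S x -> exists2 y, K y & `|x - y| <= e) ->
  precompact S.
Proof.
move=> approx; rewrite precompactE compact_ultra => F FU FS.
have clS x e : 0 < e -> closure S x -> exists2 s, S s & `|x - s| < e.
  move=> e0 /(_ _ (nbhsx_ballx x e e0))[s [Ss]]; rewrite -ball_normE => xs.
  by exists s.
suff /cauchy_cvgP/cvg_ex[l Fl] : cauchy F.
  by exists l; split => //; exact: (closed_cvg (u_ := id) _ (@closed_closure _ S) FS _ Fl).
apply: cauchy_exP => e e0; have e3 : 0 < e / 3 by rewrite divr_gt0.
have [K + SK] := approx _ e3; rewrite precompactE => preK.
(* One third of [e] leads from [closure S] into [S], one from [S] into [K]; the last is kept for the
   distance to the cluster point. *)
have /choice[pi piP] : forall x, exists y, closure S x -> K y /\ `|x - y| < e - e / 3.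
  move=> x; have [Sx|] := pselect (closure S x); last by exists 0.
  have [s Ss xs] := clS x _ e3 Sx; have [y Ky sy] := SK s Ss; exists y; split => //.
  have := ler_normD (x - s) (s - y); rewrite addrA subrK; lra.
pose P (y : X) := [set x | `|pi x - y| < e / 3].
have GK : F (pi @^-1` closure K).
  by apply: filterS FS => x Sx; have [Kpi _] := piP x Sx; exact: (subset_closure Kpi).
have [y [_ Gy]] := preK _ (fmap_proper_filter _ _) GK.
have FP : F (P y).
  have [//|FNP] := in_ultra_setVsetC (P y) FU.
  have [x [+ yx]] := Gy (~` [set x | `|x - y| < e / 3]) _ FNP (nbhsx_ballx y _ e3).
  by case; rewrite /= distrC; move: yx; rewrite -ball_normE.
exists y; apply: filterS2 FS FP => x Sx xy; have [_ xpi] := piP x Sx; rewrite -ball_normE /= distrC.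
have := ler_normD (x - pi x) (pi x - y); rewrite addrA subrK.
move: xpi xy; rewrite /P /=; lra.
Qed.

(** If [|y k| >= e] infinitely often, those terms cluster at some [z]. A functional norming [z]
    tends to [0] along [y], which forces [|z| < e / 2], against [|y k| >= e] for [y k] near [z]. *)
Lemma precompact_weakly_null (R : realType) (X : normedModType R) (y : nat -> X) :
  precompact (range y) -> weakly_null y -> `|y n| @[n --> \oo] --> (0 : R).
Proof.
move=> cy ynull; apply/cvgr0Pnorm_lt => e e0; apply: contrapT => /not_near_infty bad.
pose B := [set k | ~ `|y k| < e].
have BF : ProperFilter (within B \oo).
  apply: Build_ProperFilter => -[K _ BK]; have [k Kk nk] := bad K.
  by apply: (BK k Kk); rewrite /B /= -(normr_id (y k)).
move: cy; rewrite precompactE => cy.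
have [z [_ Gz]] : closure (range y) `&` cluster (y @ within B \oo) !=set0.
  by apply: cy; apply: nearW => k _; apply: subset_closure; exists k.
have e4 : 0 < e / 4 by rewrite divr_gt0.
have [h [h1 hz]] := norming_functional z.
have hnull : h (y k) @[k --> \oo] --> (0 : R^o).
  by apply: ynull; apply: (linear_bound_continuous (C := 1)) => x; rewrite mul1r.
have [N _ hN] := cvgr0_norm_lt _ hnull _ e4.
have [|_ [[k [Nk Bk] <-]]] := Gz (y @` ([set k | (N <= k)%N] `&` B)) _ _ (nbhsx_ballx z _ e4).
  by exists N => // k /= Nk Bk; exists k.
rewrite -ball_normE /= => zk.
have := hN k Nk; have := le_lt_trans (h1 (z - y k)) zk.
have := ler_normD (y k - z) z; rewrite subrK distrC linearB /= hz.
move: Bk zk => /negP; rewrite -leNgt.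
move: `|z - y k| `|z| `|y k| => r s t et r4 trs /ltr_normlP[_ +] /ltr_normlP[_ +].
lra.
Qed.

Section Lattice.
Context {R : realType} {E : banachLatticeType R}.
Implicit Types (x z : E) (u : nat -> E).

Lemma norm_vabs x : `|vabs x| = `|x|.
Proof. by apply: le_anti; rewrite !vabs_norm_le// vabs_abs vle_refl. Qed.

Lemma vle_norm x z : vle (vabs x) z -> `|x| <= `|z|.
Proof.
move=> xz; rewrite vabs_norm_le// (vabs_id (vle_trans (vabs_ge0 x) xz)).
exact: xz.
Qed.

Lemma disjoint_sum_norm_le u x N : disjoint_seq u ->
  (forall i, vle (vabs (u i)) x) -> `|\sum_(i < N) u i| <= `|x|.
Proof.
move=> uu ux; apply: vle_norm; apply: vle_trans (vabs_sum _ _ _) _.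
apply: (vsum_disjoint_le (u := fun i => vabs (u i))) => // [i|].
  exact: vabs_ge0.
exact: vle_trans (vabs_ge0 _) (ux 0%N).
Qed.

(** * Moduli of a functional localized on principal ideals *)

Section LocalizedNorm.
Context (f : {linear E -> R^o}) (C : R).
Hypotheses (C0 : 0 <= C) (fC : forall x, `|f x| <= C * `|x|).

(* The value at [|x|] of the component of the modulus of [f] in the band of
   functionals carried by the ideal generated by [w]. *)
Definition local_values (w x : E) : set R :=
  [set f z | z in [set z | vle (vabs z) (vabs x) /\
                           exists2 t, 0 <= t & vle (vabs z) (t *: vabs w)]].

Definition local_norm w x : R := sup (local_values w x).

Lemma local_values0 w x : local_values w x 0.
Proof.
exists 0; last exact: linear0.
by split; rewrite /= vabs0 ?vabs_ge0//; exists 0 => //; rewrite scale0r vle_refl.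
Qed.

Lemma local_values_ub w x : ubound (local_values w x) (C * `|x|).
Proof.
move=> _ [z [zx _] <-]; apply: (le_trans (ler_norm _)).
by apply: le_trans (fC _) _; rewrite ler_wpM2l// vabs_norm_le.
Qed.

Lemma local_norm_ge w x z t : 0 <= t -> vle (vabs z) (vabs x) ->
  vle (vabs z) (t *: vabs w) -> f z <= local_norm w x.
Proof.
move=> t0 zx zw; apply: ub_le_sup; first by exists (C * `|x|); exact: local_values_ub.
by exists z => //; split => //; exists t.
Qed.

Lemma local_norm_le w x M : (forall z t, 0 <= t -> vle (vabs z) (vabs x) ->
  vle (vabs z) (t *: vabs w) -> f z <= M) -> local_norm w x <= M.
Proof.
move=> fM; apply: ge_sup; first by exists 0; exact: local_values0.
by move=> _ [z [zx [t t0 zw]] <-]; exact: fM zw.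
Qed.

(** The Riesz decomposition splits a competitor for [x + y] into competitors for [x] and [y], both
    under the same multiple of [|w|]. *)
Lemma local_normD w x y : local_norm w (x + y) <= local_norm w x + local_norm w y.
Proof.
apply: local_norm_le => z t t0 zxy zw.
have [z1 [z2 [zE z1x z2y z1z z2z]]] := riesz_decomposition (vabs_ge0 x) (vabs_ge0 y)
  (vle_trans zxy (vabs_triangle x y)).
rewrite zE linearD; apply: lerD.
  exact: local_norm_ge t0 z1x (vle_trans z1z zw).
exact: local_norm_ge t0 z2y (vle_trans z2z zw).
Qed.

Lemma local_normZ_le w x t : 0 < t -> local_norm w (t *: x) <= t * local_norm w x.
Proof.
move=> t0; have tV : 0 < t^-1 by rewrite invr_gt0.
apply: local_norm_le => z s s0 zx zw.
have zE : f z = t * f (t^-1 *: z).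
  by rewrite linearZ /= /GRing.scale /= mulrA mulfV ?mul1r// gt_eqF.
rewrite zE ler_pM2l//; have := vle_trans (vabs_scale t^-1 z) _; rewrite gtr0_norm// => zt.
apply: (local_norm_ge (t := t^-1 * s)); first by rewrite mulr_ge0// ltW.
  apply: zt; apply: vle_trans (vle_scale (ltW tV) zx) _.
  apply: vle_trans (vle_scale (ltW tV) (vabs_scale t x)) _.
  by rewrite gtr0_norm// scalerA mulVf ?gt_eqF// scale1r vle_refl.
by apply: zt; rewrite -scalerA; exact: vle_scale (ltW tV) zw.
Qed.

Lemma local_norm0 w : local_norm w 0 = 0.
Proof.
apply: le_anti; rewrite (ub_le_sup _ (local_values0 w 0)) ?andbT; last first.
  by exists (C * `|0 : E|); exact: local_values_ub.
apply: ge_sup; first by exists 0; exact: local_values0.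
by move=> r /local_values_ub; rewrite normr0 mulr0.
Qed.

Lemma local_normZ w t x : 0 <= t -> local_norm w (t *: x) = t * local_norm w x.
Proof.
rewrite le_eqVlt => /orP[/eqP <-|t0]; first by rewrite scale0r mul0r local_norm0.
apply: le_anti; rewrite local_normZ_le//=.
have := @local_normZ_le w (t *: x) t^-1; rewrite invr_gt0 => /(_ t0).
rewrite scalerA mulVf ?gt_eqF// scale1r -(ler_pM2l t0) mulrA mulfV ?gt_eqF//.
by rewrite mul1r.
Qed.

Lemma local_normN w x : local_norm w (- x) = local_norm w x.
Proof. by rewrite /local_norm /local_values vabsN. Qed.

(** Nearly optimal [z k] are dominated by multiples of the disjoint [|w k|], hence disjoint; their
    sum then has norm at most that of [x]. *)
Lemma local_norm_sum_le (w : nat -> E) N x : disjoint_seq w ->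
  \sum_(k < N) local_norm (w k) x <= C * `|x|.
Proof.
move=> ww; apply/ler_addgt0Pr => e e0.
have eN : 0 < e / N.+1%:R by rewrite divr_gt0.
have /choice[z zP] k : exists z, [/\ local_norm (w k) x - e / N.+1%:R < f z,
    vle (vabs z) (vabs x) & exists2 t, 0 <= t & vle (vabs z) (t *: vabs (w k))].
  have hs : has_sup (local_values (w k) x).
    by split; [exists 0; exact: local_values0|exists (C * `|x|); exact: local_values_ub].
  by have [_ [z [zx zw] <-] fz] := sup_adherent eN hs; exists z.
have zz : disjoint_seq z.
  move=> i j ij; have [_ _ [s s0 zs]] := zP i; have [_ _ [t t0 zt]] := zP j.
  (* A common factor for both bounds; the [1] makes it positive, as [vmeet_scale] requires. *)
  have st : 0 < s + t + 1 by lra.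
  apply: (@vmeet_le_eq0 _ _ _ ((s + t + 1) *: vabs (w i)) _ ((s + t + 1) *: vabs (w j)));
    rewrite ?vabs_ge0 ?vmeet_scale ?ww ?scaler0//.
    by apply: vle_trans zs _; apply: vle_scaler (vabs_ge0 _); lra.
  by apply: vle_trans zt _; apply: vle_scaler (vabs_ge0 _); lra.
have : f (\sum_(k < N) z k) <= C * `|x|.
  apply: le_trans (ler_norm _) (le_trans (fC _) _); rewrite ler_wpM2l//.
  rewrite -(norm_vabs x); apply: disjoint_sum_norm_le => // i.
  by have [] := zP i.
rewrite linear_sum; suff : \sum_(k < N) local_norm (w k) x <= \sum_(k < N) f (z k) + e by lra.
apply: (@le_trans _ _ (\sum_(k < N) (f (z k) + e / N.+1%:R))).
  by apply: ler_sum => k _; have [fz _ _] := zP k; rewrite -lerBlDr; exact: ltW.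
rewrite big_split /= lerD2l sumr_const card_ord -[X in X <= _]mulr_natr -mulrA.
by rewrite ler_piMr ?(ltW e0)// mulrC ler_pdivrMr// mul1r ler_nat.
Qed.

(** Hahn-Banach for the sublinear [local_norm (u k)], touched at [x k]. Evenness of [local_norm]
    bounds [|g k z|], and [u k] and [- u k] are themselves competitors at [x k]. *)
Lemma disjoint_majorant u (x : nat -> E) :
  disjoint_seq u -> (forall k, vle (vabs (u k)) (vabs (x k))) ->
  exists g : nat -> {linear E -> R^o},
    (forall N z, \sum_(k < N) `|g k z| <= C * `|z|) /\
    forall k, `|f (u k)| <= g k (x k).
Proof.
move=> uu ux.
have /choice[g gP] k : exists g : {linear E -> R^o},
    (forall z, g z <= local_norm (u k) z) /\ g (x k) = local_norm (u k) (x k).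
  by apply: hahn_banach; [exact: local_normD|move=> t z; exact: local_normZ].
exists g; split=> [N z|k].
  apply: le_trans (local_norm_sum_le N z uu); apply: ler_sum => k _.
  have [gz _] := gP k; rewrite ler_norml gz andbT.
  by have := gz (- z); rewrite linearN local_normN /=; lra.
have [_ ->] := gP k; rewrite ler_norml; apply/andP; split.
  rewrite lerNl -linearN; apply: (local_norm_ge ler01); rewrite vabsN//.
  by rewrite scale1r vle_refl.
by apply: (local_norm_ge ler01) => //; rewrite scale1r vle_refl.
Qed.

End LocalizedNorm.

(** All majorants are evaluated at the one vector [x], where their values are summable and so tend
    to [0]. *)
Lemma disjoint_order_bounded_weakly_null u x : disjoint_seq u ->
  (forall k, vle (vabs (u k)) (vabs x)) -> weakly_null u.
Proof.
move=> uu ux f /continuous_linear_bound[C C0 fC].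
have [g [gC fg]] := disjoint_majorant C0 fC (x := fun=> x) uu ux.
have gx := functional_cvg0 gC x.
apply/cvgr0Pnorm_lt => e /(cvgr0_norm_lt _ gx); apply: filterS => k.
by apply: le_lt_trans; apply: le_trans (fg k) (ler_norm _).
Qed.

Lemma disjoint_weakly_null u (x : nat -> E) (n : nat -> nat) : disjoint_seq u ->
  weakly_null x -> (forall k, vle (vabs (u k)) (vabs (x (n k)))) -> weakly_null u.
Proof.
move=> uu xnull ux f /continuous_linear_bound[C C0 fC].
have [g [gC fg]] := disjoint_majorant C0 fC (x := x \o n) uu ux.
have gx := diagonal_cvg0 gC n xnull.
apply/cvgr0Pnorm_lt => e /(cvgr0_norm_lt _ gx); apply: filterS => k.
by apply: le_lt_trans; apply: le_trans (fg k) (ler_norm _).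
Qed.

End Lattice.

(** * Almost order bounded images *)

Section AlmostOrderBounded.
Context {R : realType} {E : banachLatticeType R}.

(** The positive cone is norm closed: eventually [(z - l)^+ <= |s N - l|], whose norm tends to
    [0]. *)
Lemma vle_lim (s : nat -> E) (z l : E) :
  (\forall N \near \oo, vle z (s N)) -> s @ \oo --> l -> vle z l.
Proof.
move=> zs sl; pose d := vjoin (z - l) 0.
suff d0 : d = 0.
  by have := vle_joinEl (z - l) 0; rewrite -/d d0 vle_subr_addr add0r.
apply/eqP; rewrite -normr_eq0 eq_le normr_ge0 andbT; apply/ler_addgt0Pr => e e0.
rewrite add0r; near \oo => N.
apply: (@le_trans _ _ `|l - s N|); last first.
  by near: N; exact: cvgr_dist_le.
rewrite distrC -norm_vabs; apply: vle_norm.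
rewrite vabs_id; last exact: vle_joinEr.
rewrite vle_joinl vabs_ge0 andbT; apply: vle_trans (vle_abs _).
by apply: vle_addr; near: N; exact: zs.
Unshelve. all: by end_near. Qed.

(** The bound is the sum of the absolutely convergent series of the [2 ^ (- n) y n], whose terms are
    positive. *)
Lemma geometric_upper_bound (y : nat -> E) M :
  (forall n, vle 0 (y n)) -> (forall n, `|y n| <= M) ->
  exists x : E, forall n, vle (2^-1 ^+ n *: y n) x.
Proof.
move=> y0 yM; pose s := series (fun n => 2^-1 ^+ n *: y n).
have half1 : `|2^-1 : R| < 1 by rewrite ger0_norm; lra.
have scvg : cvgn s.
  apply: normed_cvg.
  apply: (series_le_cvg (v_ := geometric M 2^-1)) (is_cvg_geometric_series half1).
  - by move=> n; exact: normr_ge0.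
  - by move=> n; rewrite /geometric /= mulr_ge0 ?exprn_ge0// (le_trans _ (yM n)).
  - move=> n; rewrite /geometric /= normrZ ger0_norm ?exprn_ge0//.
    by rewrite mulrC ler_wpM2r ?exprn_ge0.
have y0' n : vle 0 (2^-1 ^+ n *: y n) by apply: vle_scale0; rewrite ?exprn_ge0.
exists (limn s) => n; apply: vle_lim scvg; exists n.+1 => // N /= nN.
rewrite /s /series /= (bigD1_seq n) ?mem_index_iota ?iota_uniq//=.
by apply: vle_addr0; exact: vle0_sum.
Qed.

Lemma vpos_sub_neg (x : E) : x = vjoin x 0 - vjoin (- x) 0.
Proof.
apply: vle_eq.
  rewrite vle_subl_addr addrC -vle_subl_addr vle_joinl; apply/andP; split.
    by rewrite vle_subl_addr addNr; exact: vle_joinEr.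
  by rewrite vle_sub0; exact: vle_joinEl.
rewrite vle_subr_addr vle_joinl vle_addr0 ?vle_joinEr//=.
by rewrite addrC -vle_subr_addr sub0r; exact: vle_joinEl.
Qed.

Lemma vpos_le_abs (x : E) : vle (vabs (vjoin x 0)) (vabs x).
Proof. by rewrite vabs_id ?vle_joinEr// vle_joinl vle_abs vabs_ge0. Qed.

(** [y - (y - w)^+] is the infimum of [y] and [w]. *)
Lemma vtruncate (y w : E) : vle 0 y -> vle 0 w ->
  vle 0 (y - vjoin (y - w) 0) && vle (y - vjoin (y - w) 0) w.
Proof.
move=> y0 w0; rewrite vle_sub0 vle_joinl y0 andbT vle_subr_addr vle_addr0//=.
by rewrite vle_subr_addr addrC -vle_subr_addr; exact: vle_joinEl.
Qed.

(* If no [w] works, choose inductively [y n] with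
   [`|T (y n - 4 ^ n * \sum_(i < n) y i)^+| >= e]; subtracting in addition
   [2 ^ (- n) * x] with [x := \sum_i 2 ^ (- i) * y i] makes these positive parts
   disjoint, at the price of a norm-null perturbation. *)
Lemma almost_order_bounded {X : normedModType R} (T : {linear E -> X}) (C M e : R)
    (S : set E) :
  0 <= C -> (forall x, `|T x| <= C * `|x|) ->
  (forall y z, S y -> vle (vabs z) (vabs y) -> S z) ->
  (forall y, S y -> `|y| <= M) ->
  (forall u : nat -> E, (forall n, S (u n)) -> disjoint_seq u ->
    `|T (u n)| @[n --> \oo] --> (0 : R)) ->
  0 < e ->
  exists2 w, vle 0 w & forall y, S y -> vle 0 y -> `|T (vjoin (y - w) 0)| <= e.
Proof.
move=> C0 TC solS SM TS e0; apply: contrapT => bad.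
have /choice[phi phiP] w : exists y, vle 0 w ->
    [/\ S y, vle 0 y & e < `|T (vjoin (y - w) 0)|].
  have [w0|] := pselect (vle 0 w); last by exists 0.
  apply: contrapT => nex; apply: bad; exists w => // y Sy y0.
  by rewrite leNgt; apply/negP => ey; apply: nex; exists y.
(* [s n] is the sum of the [y i] with [i < n]. *)
pose s := fix s n := if n is n'.+1 then s n' + phi (4 ^+ n' *: s n') else 0.
pose y n := phi (4 ^+ n *: s n).
have p4 n : 0 <= 4 ^+ n :> R by rewrite exprn_ge0.
have p2 n : 0 <= 2^-1 ^+ n :> R by rewrite exprn_ge0.
have s0 n : vle 0 (s n).
  elim: n => [|n IH] /=; first exact: vle_refl.
  have [_ phi0 _] := phiP _ (vle_scale0 (p4 n) IH).
  exact: vle_trans IH (vle_addr0 _ phi0).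
have yP n : [/\ S (y n), vle 0 (y n) & e < `|T (vjoin (y n - 4 ^+ n *: s n) 0)|].
  by apply: phiP; exact: vle_scale0.
have y0 n : vle 0 (y n) by have [] := yP n.
have ys n m : (n < m)%N -> vle (y n) (s m).
  elim: m => // m IH; rewrite ltnS leq_eqVlt => /orP[/eqP ->|nm] /=.
    by rewrite addrC; exact: vle_addr0.
  exact: vle_trans (IH nm) (vle_addr0 _ (y0 m)).
have [|x xP] := geometric_upper_bound y0 (M := M).
  by move=> n; apply: SM; have [] := yP n.
have x0 : vle 0 x by apply: vle_trans (xP 0%N); exact: vle_scale0.
pose w n := vjoin (y n - 4 ^+ n *: s n) 0.
pose v n := vjoin (y n - 4 ^+ n *: s n - 2^-1 ^+ n *: x) 0.
have v0 n : vle 0 (v n) by exact: vle_joinEr.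
have px0 n : vle 0 (2^-1 ^+ n *: x) by exact: vle_scale0.
have v_le1 n m : (n < m)%N -> vle (v m) (vjoin (y m - 4 ^+ m *: y n) 0).
  move=> nm; rewrite /v vle_joinl vle_joinEr andbT; apply: vle_trans (vle_joinEl _ _).
  rewrite vle_subr_addr; apply: vle_trans (vle_addr0 _ (px0 m)).
  exact/vle_addl/vle_opp/vle_scale/ys.
have v_le2 n m : vle (v n) (vjoin (y n - 2^-1 ^+ (n + m) *: y m) 0).
  rewrite /v vle_joinl vle_joinEr andbT; apply: vle_trans (vle_joinEl _ _).
  rewrite addrAC vle_subr_addr; apply: vle_trans (vle_addr0 _ (vle_scale0 (p4 n) (s0 n))).
  by apply/vle_addl/vle_opp; rewrite exprD -scalerA; exact: vle_scale.
(* [vpos_disjoint] applies with factors [4 ^ m] and [2 ^ (- (n + m))], whose product is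
   [2 ^ (m - n) >= 1]. *)
have vv n m : (n < m)%N -> vmeet (v m) (v n) = 0.
  move=> nm; apply: (vpos_disjoint (v0 m) (v0 n) (y0 m) _ _ (v_le1 _ _ nm) (v_le2 n m)).
    by rewrite exprn_ege1// ler1n.
  have -> : 4 = 2 ^+ 2 :> R by lra.
  rewrite -exprM exprVn ler_pdivlMr ?exprn_gt0// mul1r ler_eXn2l ?ltr1n//.
  by rewrite mul2n -addnn leq_add2r ltnW.
have v_disj : disjoint_seq v.
  move=> n m /eqP; rewrite !vabs_id// neq_ltn => /orP[nm|]; last exact: vv.
  by rewrite vmeetC; exact: vv.
have v_le n : vle (v n) (w n).
  rewrite /v vle_joinl vle_joinEr andbT; apply: vle_trans (vle_joinEl _ _).
  by rewrite vle_subr_addr; exact: vle_addr0.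
have w_le n : vle (w n) (y n).
  by rewrite /w vle_joinl y0 andbT vle_subr_addr; apply: vle_addr0; exact: vle_scale0.
have Sv n : S (v n).
  have [Sy _ _] := yP n; apply: solS Sy _; rewrite !vabs_id//.
  exact: vle_trans (v_le n) (w_le n).
have wv n : `|w n - v n| <= 2^-1 ^+ n * `|x|.
  rewrite -[X in _ <= X * _](ger0_norm (p2 n)) -normrZ; apply: vle_norm.
  rewrite vabs_id ?vle_sub0// vle_subr_addr addrC /w vle_joinl; apply/andP; split.
    by rewrite -vle_subr_addr; exact: vle_joinEl.
  exact: vle_trans (v0 n) (vle_addr0 _ (px0 n)).
have half1 : `|2^-1 : R| < 1 by rewrite ger0_norm; lra.
(* [e < |T (w n)| <= |T (v n)| + C 2 ^ (- n) |x|], and the right side tends to [0]. *)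
have bound0 : `|T (v n)| + geometric (C * `|x|) 2^-1 n @[n --> \oo] --> (0 : R).
  by rewrite -[0 in X in _ --> X]addr0; apply: cvgD; [exact: TS|exact: cvg_geometric].
have [N _ /(_ N (leqnn N))] := cvgr0_norm_lt _ bound0 _ e0.
apply/negP; rewrite -leNgt; apply: le_trans (ler_norm _).
have [_ _ /ltW/le_trans] := yP N; apply; rewrite -/(w N).
rewrite -[w N](subrK (v N)) addrC linearD; apply: le_trans (ler_normD _ _) _.
rewrite lerD2l; apply: le_trans (TC _) _; rewrite /geometric /= -mulrA [`|x| * _]mulrC.
exact: ler_wpM2l.
Qed.

End AlmostOrderBounded.

(** * DW-compact, AM-compact and Dunford-Pettis operators *)

Section DWcompact.
Context {R : realType} {E : banachLatticeType R} {X : completeNormedModType R}.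
Variable T : {linear E -> X}.

Lemma bounded_setP (A : set E) : bounded_set A <-> exists M, forall x, A x -> `|x| <= M.
Proof.
split=> [/pinfty_ex_gt0[M _ AM]|[M AM]]; first by exists M.
by exists M; rewrite num_real; split => // M' /ltW MM' x /AM /le_trans; exact.
Qed.

Lemma order_bounded_abs (A : set E) : order_bounded A ->
  exists2 c, vle 0 c & forall x, A x -> vle (vabs x) c.
Proof.
move=> [a [b ab]]; exists (vabs a + vabs b).
  exact: vle_trans (vabs_ge0 a) (vle_addr0 _ (vabs_ge0 b)).
move=> x /ab[ax xb]; rewrite vabs_le; apply/andP; split.
  rewrite addrC; apply: vle_trans (vle_addr0 _ (vabs_ge0 a)).
  exact: vle_trans xb (vle_abs b).
apply: vle_trans (vle_addr0 _ (vabs_ge0 b)).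
exact: vle_trans (vle_opp ax) (vle_absN a).
Qed.

(** Disjoint sequences in the solid hull of an order bounded set stay in one order interval, hence
    are weakly null. *)
Lemma DW_compact_AM_compact : DW_compact T -> AM_compact T.
Proof.
move=> TDW A /order_bounded_abs[c c0 Ac]; apply: TDW; split.
  by apply/bounded_setP; exists `|c| => x /Ac; exact: vle_norm.
move=> u uA uu; apply: (disjoint_order_bounded_weakly_null (x := c) uu) => k.
by have [x Ax ux] := uA k; rewrite (vabs_id c0) (vle_trans ux (Ac x Ax)).
Qed.

Hypothesis hT : bounded_fun_norm T.

Lemma bounded_fun_norm_linear_bound : exists2 C, 0 <= C & forall x, `|T x| <= C * `|x|.
Proof.
apply: continuous_linear_bound; apply: bounded_linear_continuous.
have [M MT] := hT 1; apply/ex_bound; exists M; apply/nbhs_norm0P; exists 1 => //= x x1.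
by apply: MT; exact: ltW.
Qed.

Lemma DW_compact_dunford_pettis : DW_compact T -> dunford_pettis T.
Proof.
move=> TDW x xnull; have [C C0 TC] := bounded_fun_norm_linear_bound.
apply: (@precompact_weakly_null R X (T \o x)); last first.
  move=> f fcont; apply: (xnull (f \o T : {linear _ -> _})).
  move=> z; apply: continuous_comp; last exact: fcont.
  exact: linear_bound_continuous TC z.
have -> : range (T \o x) = T @` range x by rewrite image_comp.
apply: TDW; split.
  have [M xM] := weakly_null_bounded xnull.
  by apply/bounded_setP; exists M => _ [n _ <-].
move=> u uA uu.
have /choice[n un] k : exists n, vle (vabs (u k)) (vabs (x n)).
  by have [_ [n _ <-] un] := uA k; exists n.
exact: disjoint_weakly_null uu xnull un.
Qed.

Lemma AM_almost_DP_DW_compact : AM_compact T -> almost_dunford_pettis T -> DW_compact T.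
Proof.
move=> TAM TDP A [/bounded_setP[M AM] Anull].
have [C C0 TC] := bounded_fun_norm_linear_bound.
apply: precompact_approx => e e0; have e2 : 0 < e / 2 by rewrite divr_gt0.
have [|||w w0 wP] := almost_order_bounded (S := solid_hull A) (M := M) C0 TC _ _ _ e2.
- by move=> y z [x Ax yx] zy; exists x => //; exact: vle_trans zy yx.
- by move=> y [x Ax yx]; apply: le_trans (AM x Ax); exact: vabs_norm_le.
- by move=> u uA uu; apply: TDP => //; exact: Anull.
exists (T @` [set z | vle (vabs z) w]).
  apply: TAM; exists (- w), w => z /= zw; split; last exact: vle_trans (vle_abs z) zw.
  exact: vle_trans (vle_opp zw) (vge_absN z).
(* [r y] is the part of [y^+] above [w]; taken at [x] and [- x], it costs [e / 2] for each of [x^+]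
   and [x^-]. *)
move=> _ [x Ax <-]; pose r y := vjoin (vjoin y 0 - w) 0.
have Tr y : vle (vabs y) (vabs x) -> `|T (r y)| <= e / 2.
  move=> yx; apply: wP (vle_joinEr _ _); exists x => //.
  exact: vle_trans (vpos_le_abs y) yx.
have trunc y : vle 0 (vjoin y 0 - r y) && vle (vjoin y 0 - r y) w.
  by apply: vtruncate => //; exact: vle_joinEr.
(* A difference of two elements between [0] and [w] lies between [- w] and [w]. *)
exists (T ((vjoin x 0 - r x) - (vjoin (- x) 0 - r (- x)))).
  exists ((vjoin x 0 - r x) - (vjoin (- x) 0 - r (- x))) => //=.
  move: (trunc x) (trunc (- x)); move: (vjoin x 0 - r x) (vjoin (- x) 0 - r (- x)) => a b.
  move=> /andP[a0 aw] /andP[b0 bw].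
  rewrite vabs_le opprB; apply/andP; split.
    by rewrite vle_subr_addr; apply: vle_trans aw (vle_addr0 _ b0).
  by rewrite vle_subr_addr; apply: vle_trans bw (vle_addr0 _ a0).
rewrite -linearB {1}[x]vpos_sub_neg.
have -> : forall p q a b : E, p - q - (p - a - (q - b)) = a - b.
  move=> p q a b; rewrite !opprD !opprK addrACA !addrA.
  by rewrite subrr add0r -!addrA; congr (_ + _); rewrite addrA addNr add0r.
rewrite linearB; apply: le_trans (ler_normB _ _) _.
rewrite [e]splitr; apply: lerD; apply: Tr; rewrite ?vabsN; exact: vle_refl.
Qed.

End DWcompact.

Theorem theorem2p5 (R : realType) (E : banachLatticeType R)
    (X : completeNormedModType R) (T : {linear E -> X})
    (hT : bounded_fun_norm T) :
  [<-> DW_compact T;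
       AM_compact T /\ dunford_pettis T;
       AM_compact T /\ almost_dunford_pettis T].
Proof.
tfae.
- move=> TDW; split; first exact: DW_compact_AM_compact.
  exact: DW_compact_dunford_pettis.
- by move=> [TAM TDP]; split => // u _; exact: TDP.
- by move=> [TAM TDP]; exact: AM_almost_DP_DW_compact.
Qed.
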